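(* Let $t\geq 1$, $k\geq 2$ and $n\geq (7k-2)t+4$ be integers, let $H^*=K_t\vee(K_{n-kt-1}\cup(kt-t+1)K_1)$, and let $G$ be a $t$-connected graph of order $n$. Define $$f(n,k,t)=\Big(1+\frac{(k-2)t}{n}\Big)\Big((n-1-t)(kt-t+1)+n-\frac12(k-1)^2t^2-\frac52kt+\frac32t-5\Big).$$ If $\rho(\overline{G})\leq \sqrt{f(n,k,t)}$, then $G$ has a spanning $k$-tree unless $C_{n-(k-2)t-1}(G)\cong H^*$.
   Context: All graphs are finite, simple and undirected. $\overline{G}$ is the complement of $G$, and $\rho(\cdot)$ is the largest eigenvalue of the adjacency matrix. A graph is $t$-connected if it has more than $t$ vertices and remains connected whenever fewer than $t$ vertices are removed. $K_m$ is the complete graph on $m$ vertices; $mG$ is the disjoint union of $m$ copies of $G$; $\cup$ denotes disjoint union and $\vee$ denotes join. A spanning $k$-tree of $G$ is a spanning tree of $G$ with maximum degree at most $k$. For an integer $l$, the $l$-closure $C_l(G)$ of $G$ is the graph obtained from $G$ by recursively joining pairs of nonadjacent vertices whose degree sum (in the current graph) is at least $l$, until no such pair remains. *)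

(* Defs.v *)
From mathcomp Require Import all_boot all_order all_algebra.
From mathcomp Require Import all_classical all_reals.

Set Implicit Arguments.
Unset Strict Implicit.
Unset Printing Implicit Defensive.

Import Order.TTheory GRing.Theory Num.Theory.

(* Finite simple graphs with vertex set T. *)
Record sgraph (T : finType) := SGraph {
  adj :> rel T;
  adj_sym : symmetric adj;
  adj_irr : irreflexive adj
}.

Definition giso (T1 T2 : finType) (G1 : sgraph T1) (G2 : sgraph T2) : Prop :=
  exists2 f : T1 -> T2, bijective f & forall x y, G2 (f x) (f y) = G1 x y.

Section Constructions.
Variables (T T' : finType) (G : sgraph T) (G' : sgraph T').

Definition compl_rel : rel T := fun x y => (x != y) && ~~ G x y.
Lemma compl_sym : symmetric compl_rel.
Proof. by move=> x y; rewrite /compl_rel eq_sym adj_sym. Qed.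
Lemma compl_irr : irreflexive compl_rel.
Proof. by move=> x; rewrite /compl_rel eqxx. Qed.
Definition compl : sgraph T := SGraph compl_sym compl_irr.

Definition gunion_rel : rel (T + T') := fun u v =>
  match u, v with
  | inl x, inl y => G x y
  | inr x, inr y => G' x y
  | _, _ => false
  end.
Lemma gunion_sym : symmetric gunion_rel.
Proof. by move=> [x|x] [y|y] //=; rewrite adj_sym. Qed.
Lemma gunion_irr : irreflexive gunion_rel.
Proof. by move=> [x|x] /=; rewrite adj_irr. Qed.
Definition gunion : sgraph (T + T')%type := SGraph gunion_sym gunion_irr.

Definition gjoin_rel : rel (T + T') := fun u v =>
  match u, v with
  | inl x, inl y => G x y
  | inr x, inr y => G' x y
  | _, _ => true
  end.
Lemma gjoin_sym : symmetric gjoin_rel.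
Proof. by move=> [x|x] [y|y] //=; rewrite adj_sym. Qed.
Lemma gjoin_irr : irreflexive gjoin_rel.
Proof. by move=> [x|x] /=; rewrite adj_irr. Qed.
Definition gjoin : sgraph (T + T')%type := SGraph gjoin_sym gjoin_irr.

Definition copies_rel (m : nat) : rel ('I_m * T) := fun u v =>
  (u.1 == v.1) && G u.2 v.2.
Lemma copies_sym m : symmetric (@copies_rel m).
Proof. by move=> u v; rewrite /copies_rel eq_sym adj_sym. Qed.
Lemma copies_irr m : irreflexive (@copies_rel m).
Proof. by move=> u; rewrite /copies_rel adj_irr andbF. Qed.
Definition copies (m : nat) : sgraph ('I_m * T)%type :=
  SGraph (@copies_sym m) (@copies_irr m).

Definition induced_rel (A : {set T}) : rel {x : T | x \in A} :=
  fun u v => G (val u) (val v).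
Lemma induced_sym A : symmetric (@induced_rel A).
Proof. by move=> u v; rewrite /induced_rel adj_sym. Qed.
Lemma induced_irr A : irreflexive (@induced_rel A).
Proof. by move=> u; rewrite /induced_rel adj_irr. Qed.
Definition induced (A : {set T}) : sgraph {x : T | x \in A} :=
  SGraph (@induced_sym A) (@induced_irr A).

(* The guard x != y keeps the graph loopless. *)
Definition add_edge_rel (x y : T) : rel T := fun u v =>
  G u v || (x != y) && ((u == x) && (v == y) || (u == y) && (v == x)).
Lemma add_edge_sym x y : symmetric (add_edge_rel x y).
Proof.
by move=> u v; rewrite /add_edge_rel adj_sym orbC [X in _ && X]orbC orbC
  ![(u == _) && _]andbC.
Qed.
Lemma add_edge_irr x y : irreflexive (add_edge_rel x y).
Proof.
move=> u; rewrite /add_edge_rel adj_irr /=; case: (eqVneq u x) => [->|_] /=.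
  by case: (eqVneq x y).
by rewrite andbF andbF.
Qed.
Definition add_edge (x y : T) : sgraph T :=
  SGraph (add_edge_sym x y) (add_edge_irr x y).

End Constructions.

Lemma complete_sym m : symmetric (fun x y : 'I_m => x != y).
Proof. by move=> x y; rewrite eq_sym. Qed.
Lemma complete_irr m : irreflexive (fun x y : 'I_m => x != y).
Proof. by move=> x; rewrite eqxx. Qed.
Definition complete (m : nat) : sgraph 'I_m :=
  SGraph (@complete_sym m) (@complete_irr m).

Section Notions.
Variables (T : finType) (G : sgraph T).

Definition degree (x : T) : nat := #|[set y | G x y]|.

Definition gconnected : Prop := forall x y : T, connect G x y.

Definition acyclic : Prop := forall c : seq T, 2 < size c -> ~ ucycle G c.

Definition is_tree : Prop := gconnected /\ acyclic.

End Notions.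

Definition t_connected (t : nat) (T : finType) (G : sgraph T) : Prop :=
  t < #|T| /\
  forall S : {set T}, #|S| < t -> gconnected (induced G (~: S)).

Definition spanning_ktree (k : nat) (T : finType) (G : sgraph T) : Prop :=
  exists F : sgraph T,
    [/\ subrel F G, is_tree F & forall x, degree F x <= k].

(* One step of the l-closure: join one nonadjacent pair of degree sum at least
   l, if there is any.  Each effective step adds an edge, so #|T| ^ 2 steps
   reach the point where no such pair remains; the result does not depend on
   the order in which pairs are picked. *)
Definition closure_step (l : nat) (T : finType) (G : sgraph T) : sgraph T :=
  if [pick p : T * T | [&& p.1 != p.2, ~~ G p.1 p.2
                         & l <= degree G p.1 + degree G p.2]] is Some p
  then add_edge G p.1 p.2 else G.

Definition gclosure (l : nat) (T : finType) (G : sgraph T) : sgraph T :=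
  iter (#|T| ^ 2) (@closure_step l T) G.

Definition Hstar (n k t : nat) :=
  gjoin (complete t)
    (gunion (complete (n - k * t - 1)) (copies (complete 1) (k * t - t + 1))).

Section Spectral.
Local Open Scope classical_set_scope.
Local Open Scope ring_scope.
Variable R : realType.

Definition adjmx (T : finType) (G : sgraph T) : 'M[R]_#|T| :=
  \matrix_(i, j) (G (enum_val i) (enum_val j))%:R.

Definition largest_eigenvalue (m : nat) (A : 'M[R]_m) (r : R) : Prop :=
  eigenvalue A r /\ forall a : R, eigenvalue A a -> a <= r.

(* The default value 0 is only used when T is empty: the matrix is real
   symmetric. *)
Definition rho (T : finType) (G : sgraph T) : R :=
  xget 0 [set r : R | largest_eigenvalue (adjmx G) r].

Definition fbound (n k t : nat) : R :=
  let n' : R := n%:R in let k' : R := k%:R in let t' : R := t%:R in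
  (1 + (k' - 2) * t' / n') *
  ((n' - 1 - t') * (k' * t' - t' + 1) + n'
   - 1 / 2 * (k' - 1) ^+ 2 * t' ^+ 2 - 5 / 2 * k' * t' + 3 / 2 * t' - 5).

End Spectral.

(* Main.v *)
From mathcomp Require Import all_boot all_order all_algebra.
From mathcomp Require Import all_classical all_reals.
From mathcomp.real_closed Require Import complex.
From mathcomp Require Import fintype finset ring zify.
Require Import Defs.

(* Write a = (k - 2) t, s = (k - 1) t + 1, and let H be the (n - a - 1)-closure
   of G; f is (1 + a / n) g with g the second factor in its definition.

   Closing preserves the absence of a spanning k-tree: if F is a connected
   subgraph of G + uv of maximum degree at most k using uv, F - uv splits into
   two rooted trees, and every edge of G across the split which does not allow a
   repair of F ends in a vertex all of whose k - 1 children are not adjacent to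
   the root of their tree.  By t-connectivity there are at least t such vertices,
   whence d(u) + d(v) <= n - a - 2.

   Nonadjacent vertices of H have degree sum at least n + a in its complement
   H', so that n rho(G')^2 >= sum_x d_G'(x)^2 >= sum_x d_H'(x)^2 >= (n + a) e(H'),
   and the hypothesis gives e(H') <= g.

   If H is complete it has a Hamiltonian path.  Otherwise take a nonadjacent
   pair u, v of maximal degree sum with i = d(u) <= d(v): at least i + a + 1
   vertices have degree at most i, and n - i have degree at most d(v), so that
   2 e(H') >= (i + a + 1)(2n - 3i - a - 2).  This exceeds 2 g unless i = t, and
   then H has a set I of s vertices of degree t.  Counting the remaining edges of
   H' shows that the other vertices form a clique; by closedness each of them is
   adjacent to all of I or to none of it, and by t-connectivity exactly t of them
   are adjacent to I. *)

Set Implicit Arguments.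
Unset Strict Implicit.
Unset Printing Implicit Defensive.
Import Order.TTheory GRing.Theory Num.Theory.

(** * Spanning subgraphs and closure *)

Section SymmetricClosure.
Variables (T : finType) (e : rel T).

(** Symmetrises a relation and drops its diagonal, so that edges may be prescribed in one direction
    only. *)
Definition symgraph_rel : rel T := fun x y => (x != y) && (e x y || e y x).
Lemma symgraph_sym : symmetric symgraph_rel.
Proof. by move=> x y; rewrite /symgraph_rel eq_sym orbC. Qed.
Lemma symgraph_irr : irreflexive symgraph_rel.
Proof. by move=> x; rewrite /symgraph_rel eqxx. Qed.
Definition symgraph : sgraph T := SGraph symgraph_sym symgraph_irr.

End SymmetricClosure.

Section SpanningTrees.
Variable T : finType.
Implicit Types (F G : sgraph T) (A S P : {set T}) (k t : nat).

Lemma adj_neq G x y : G x y -> x != y.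
Proof. by apply: contraTneq => ->; rewrite adj_irr. Qed.

Lemma connect_adj_sym G : connect_sym G.
Proof. exact/sym_connect_sym/adj_sym. Qed.

Lemma degree_sub F G x : subrel F G -> degree F x <= degree G x.
Proof. by move=> FG; apply/subset_leq_card/subsetP=> y; rewrite !inE => /FG. Qed.

Lemma gconnected_from F u : (forall x, connect F u x) -> gconnected F.
Proof.
by move=> Fu x y; apply: connect_trans (Fu y); rewrite connect_adj_sym.
Qed.

Definition del_edge F x y : sgraph T :=
  symgraph (fun a b => F a b && ~~ ((a == x) && (b == y) || (a == y) && (b == x))).

Lemma del_edgeE F x y a b :
  del_edge F x y a b = F a b && ~~ ((a == x) && (b == y) || (a == y) && (b == x)).
Proof.
rewrite /del_edge /= /symgraph_rel (adj_sym F b a).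
have [<-|ab] := eqVneq a b; first by rewrite adj_irr.
by case: (F a b) => //=; case: (a == x); case: (a == y); case: (b == x); case: (b == y).
Qed.

Lemma del_edge_sub F x y : subrel (del_edge F x y) F.
Proof. by move=> a b; rewrite del_edgeE => /andP[]. Qed.

Lemma gconnected_del_edge F x y :
  gconnected F -> connect (del_edge F x y) x y -> gconnected (del_edge F x y).
Proof.
move=> Fconn xy a b; apply: connect_sub (Fconn a b) => {}a {}b ab.
have [/orP[]/andP[/eqP-> /eqP->]//|nab] :=
  boolP ((a == x) && (b == y) || (a == y) && (b == x)).
  by rewrite connect_adj_sym.
by apply: connect1; rewrite del_edgeE ab.
Qed.

(** A spanning $k$-tree without acyclicity, so that pieces can be glued without checking for
    cycles. *)
Definition bounded_spanning k G :=
  exists F, [/\ subrel F G, gconnected F & forall x, degree F x <= k].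

(* Deleting edges lying on cycles keeps the subgraph connected. *)
Lemma bounded_spanning_ktree k G : bounded_spanning k G -> spanning_ktree k G.
Proof.
case=> F; have [m] := ubnP #|[set p : T * T | F p.1 p.2]|.
elim: m F => // m IHm F; rewrite ltnS => Fm [FG Fconn Fdeg].
have [Facyc|] := pselect (acyclic F); first by exists F.
move=> /existsNP[c /not_implyP[c_gt2 /contrapT]].
case: c c_gt2 => [|x [|y [|z c]]] // _.
rewrite /ucycle /= rcons_path => /andP[/and4P[xy yz zc lastx]].
rewrite !inE !negb_or => /and3P[/and3P[neq_xy neq_xz xc] /andP[neq_yz yc] _].
have xy_conn : connect (del_edge F x y) x y.
  (* The rest of the cycle leads from [y] back to [x]: it avoids [x] up to its closing edge, which
     starts at [last z c], a vertex other than [y]. *)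
  rewrite connect_adj_sym; apply: (@connect_trans _ _ (last z c)).
    apply/connectP; exists (z :: c) => //.
    have: path F y (z :: c) by rewrite /= yz.
    apply: (sub_in_path (P := [pred w | w != x])).
      move=> a b; rewrite !inE => ax bx ab.
      by rewrite del_edgeE ab (negPf ax) (negPf bx) andbF.
    rewrite /= eq_sym neq_xy eq_sym neq_xz; apply/allP => w wc /=.
    by apply: contraNneq xc => <-.
  apply: connect1; rewrite del_edgeE lastx /= negb_or !negb_and.
  have -> : last z c != y.
    apply: contraTneq (mem_last z c) => ->; rewrite inE negb_or yc andbT.
    exact: neq_yz.
  by rewrite neq_xy orbT.
apply: (IHm (del_edge F x y)).
  apply: leq_trans Fm; apply/proper_card/properP; split.
    by apply/subsetP=> p; rewrite !inE => /del_edge_sub.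
  by exists (x, y); rewrite !inE ?xy // del_edgeE !eqxx andbF.
split; first by move=> a b /del_edge_sub/FG.
  exact: gconnected_del_edge.
by move=> a; apply: leq_trans (Fdeg a); apply/degree_sub/del_edge_sub.
Qed.

(** Were [S] smaller than [t], the graph without [S] would be connected, yet none of its edges
    leaves [A], which contains [u] but not [v]. *)
Lemma t_connected_cut t G A S u v : t_connected t G ->
  u \in A -> v \notin A -> u \notin S -> v \notin S ->
  (forall x y, x \in A -> y \notin A -> G x y -> (x \in S) || (y \in S)) ->
  t <= #|S|.
Proof.
move=> [_ Gconn] uA vA uS vS cut; rewrite leqNgt; apply/negP => /Gconn.
have uS' : u \in ~: S by rewrite inE.
have vS' : v \in ~: S by rewrite inE.
move=> /(_ (exist _ u uS') (exist _ v vS')) uv.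
have cl : closed (induced G (~: S)) [pred w | val w \in A].
  move=> [x xS] [y yS] xy; rewrite !inE /=.
  have nS : ~~ ((x \in S) || (y \in S)).
    by move: (xS) (yS); rewrite !inE negb_or => -> ->.
  apply/idP/idP => [xA|yA]; apply: contraNT nS => nA; first exact: cut.
  by rewrite orbC; apply: cut => //; rewrite adj_sym.
have := closed_connect cl uv; rewrite !inE /= uA => /esym vA'.
by rewrite vA' in vA.
Qed.

Lemma t_connected_sub t G G' : subrel G G' -> t_connected t G -> t_connected t G'.
Proof.
move=> GG' [tT Gconn]; split=> // S /Gconn Sconn x y.
by apply: connect_sub (Sconn x y) => a b ab; apply: connect1; exact: GG'.
Qed.

(** The neighbourhood of [u] separates [u] from [v]. *)
Lemma t_connected_min_degree t G u v : t_connected t G ->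
  u != v -> ~~ G u v -> t <= degree G u.
Proof.
move=> Gt uv nuv; apply: (t_connected_cut (A := [set u]) (u := u) (v := v) Gt).
- by rewrite inE.
- by rewrite inE eq_sym.
- by rewrite inE adj_irr.
- by rewrite inE.
- by move=> x y; rewrite !inE => /eqP -> _ ->; rewrite orbT.
Qed.

Section Reach.
Variables (F : sgraph T) (u : T).

Fixpoint reach n w := if n is m.+1 then [exists z, F w z && reach m z] else w == u.

Lemma connect_reach w : connect F u w -> exists n, reach n w.
Proof.
rewrite connect_adj_sym => /connectP[s sP us].
elim: s w sP us => [|z s IHs] w /=; first by move=> _ uw; exists 0; rewrite /= uw.
move=> /andP[wz zs] /(IHs _ zs)[n zn]; exists n.+1 => /=.
by apply/existsP; exists z; rewrite wz.
Qed.

End Reach.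

(** [d] is the distance from [u] and [p] picks a neighbour at smaller distance; the default values
    occur only at [u] or outside its component. *)
Lemma bfs_parent F u : exists (p : T -> T) (d : T -> nat), d u = 0 /\
  forall w, connect F u w -> w != u -> F w (p w) /\ d (p w) < d w.
Proof.
pose d w := if pselect (exists n, reach F u n w) is left h then ex_minn h else 0.
have d_le w n : reach F u n w -> d w <= n.
  rewrite /d => wn; case: pselect => // h; case: ex_minnP => m _; exact.
pose p w := odflt w [pick z | F w z && (d z < d w)].
exists p, d; split; first by apply/eqP; rewrite -leqn0; apply: d_le => /=.
move=> w uw wu; rewrite /p; case: pickP => [z /andP[]//|nz].
have wn := connect_reach uw.
have: reach F u (d w) w by rewrite /d; case: pselect => // h; case: ex_minnP.
case E: (d w) => [|m] /=; first by rewrite (negPf wu).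
by move=> /existsP[z /andP[wz /d_le zm]]; have := nz z; rewrite wz /= E ltnS zm.
Qed.

(** * Rooted trees given by a parent function *)

Section RootedTree.
Variables (G : sgraph T) (A : {set T}) (u : T).
Variables (p : T -> T) (d : T -> nat).

(** The decrease of [d] along [p] makes every vertex lead to the root. Any such potential will do,
    so the same [d] can serve after [p] is changed. *)
Definition rooted := [/\ u \in A, d u = 0 & forall w, w \in A -> w != u ->
  [/\ p w \in A, G w (p w) & d (p w) < d w]].

Definition kids x := [set w in A | (w != u) && (p w == x)].

Definition parent_graph := symgraph (fun a b => [&& a \in A, a != u & b == p a]).

Lemma parent_graphP : rooted ->
  [/\ subrel parent_graph G, forall a b, parent_graph a b -> a \in A,
      forall a, a \in A -> connect parent_graph u a
    & forall a, degree parent_graph a <= #|kids a| + (a != u)].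
Proof.
case=> uA du0 pP.
have PG : forall a b, parent_graph a b -> (a \in A) && G a b.
  move=> a b /andP[_ /orP[]/and3P[aA au /eqP->]].
    by have [_ ->] := pP a aA au; rewrite aA.
  by have [-> ? _] := pP b aA au; rewrite adj_sym.
split.
- by move=> a b /PG/andP[].
- by move=> a b /PG/andP[].
- move=> a; have [m] := ubnP (d a); elim: m a => // m IHm a; rewrite ltnS => am aA.
  have [->|au] := eqVneq a u; first exact: connect0.
  have [pA Gap dlt] := pP a aA au.
  apply: connect_trans (IHm _ (leq_trans dlt am) pA) _.
  apply: connect1; rewrite /= /symgraph_rel eq_sym (adj_neq Gap) /= aA au eqxx.
  by rewrite orbT.
- move=> a; rewrite /degree; have [->|au] := eqVneq a u.
    rewrite addn0; apply/subset_leq_card/subsetP=> b.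
    rewrite !inE /= /symgraph_rel eqxx /= andbF /= => /and4P[_ -> -> /eqP ->].
    by rewrite eqxx.
  apply: (@leq_trans #|kids a :|: [set p a]|); last first.
    by rewrite (leq_trans (leq_card_setU _ _)) // cards1.
  apply/subset_leq_card/subsetP=> b.
  rewrite !inE => /andP[_ /orP[]/and3P[bA bu /eqP E]]; rewrite E eqxx ?orbT //.
  by rewrite -E bA bu.
Qed.

End RootedTree.

Section HalfTree.
Variables (G : sgraph T) (k : nat) (A : {set T}) (u : T).
Variables (p : T -> T) (d : T -> nat).
Hypothesis pA : rooted G A u p d.
Hypothesis kids_lt : forall x, x \in A -> #|kids A u p x| < k.

Local Notation children := (kids A u p).

(* The vertices of the tree at which no room for a further edge can be made by
   hanging one of their children directly below the root. *)
Definition blocked :=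
  [set x in A | [&& x != u, #|children x| == k.-1 & [forall w in children x, ~~ G u w]]].

(** The neighbours of [u], the children of blocked vertices ($k-1$ each, none adjacent to [u]) and
    [u] itself are disjoint parts of [A]. *)
Lemma card_blocked :
  #|[set w in A | G u w]| + k.-1 * #|blocked| < #|A|.
Proof.
have [uA _ _] := pA.
pose U := [set w in A | (w != u) && (p w \in blocked)].
have <- : #|U| = k.-1 * #|blocked|.
  rewrite -sum1_card (partition_big p (mem blocked)) /=; last first.
    by move=> w; rewrite !inE => /and3P[].
  rewrite mulnC -sum_nat_const; apply: eq_bigr => x xb.
  have : #|children x| = k.-1 by move: xb; rewrite inE => /and4P[_ _ /eqP].
  move=> <-; rewrite -sum1_card; apply: eq_bigl => w.
  rewrite [w \in U]in_set [RHS]in_set.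
  by have [->|_] := eqVneq (p w) x; rewrite ?xb ?andbF ?andbT.
have dU : [disjoint [set w in A | G u w] & U].
  rewrite -setI_eq0 -subset0; apply/subsetP=> w.
  rewrite in_setI => /andP[]; rewrite !in_set => /andP[wA uw] /and3P[_ wu].
  move=> /and4P[_ _ _ /forall_inP/(_ w)]; rewrite uw; apply.
  by rewrite in_set wA wu eqxx.
rewrite -cardsUI (disjoint_setI0 dU) cards0 addn0.
apply/proper_card/properP; split.
  by apply/subsetP=> w; rewrite in_setU !in_set => /orP[]/andP[].
by exists u => //; rewrite in_setU !in_set adj_irr eqxx !andbF.
Qed.

(** If [x] is the root or has fewer than $k-1$ children, the tree itself serves. Otherwise some
    child of [x] is adjacent to [u] and is hung below [u], which has room for one more. *)
Lemma unblocked_subgraph x : x \in A -> x \notin blocked -> exists F : sgraph T,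
  [/\ subrel F G, forall a b, F a b -> a \in A,
      forall a, a \in A -> connect F u a,
      forall a, degree F a <= k & degree F x < k].
Proof.
have [uA du0 pP] := pA => xA xb.
have kids_notin a : a \notin A -> children a = set0.
  move=> aA; apply/setP => w; rewrite !inE; apply: contraNF aA.
  by case/and3P => wA wu /eqP <-; have [] := pP w wA wu.
have deg_bound (q : T -> T) : rooted G A u q d ->
    (forall a, a \in A -> #|kids A u q a| + (a != u) <= k) ->
    #|kids A u q x| + (x != u) < k -> exists F : sgraph T,
    [/\ subrel F G, forall a b, F a b -> a \in A,
      forall a, a \in A -> connect F u a,
      forall a, degree F a <= k & degree F x < k].
  move=> /parent_graphP[FG FA Fu Fdeg] qk qx.
  exists (parent_graph A u q); split=> // [a|]; last exact: leq_ltn_trans qx.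
  have [aA|aA] := boolP (a \in A); first exact: leq_trans (qk a aA).
  rewrite /degree eq_card0 // => b; rewrite inE; apply: contraNF aA => /FA //.
have kids_deg a : a \in A -> #|children a| + (a != u) <= k.
  by move=> /kids_lt; case: (a != u); rewrite ?addn1 ?addn0 // => /ltnW.
have [xu|xu] := eqVneq x u.
  by apply: (deg_bound p) => //; rewrite xu eqxx addn0 kids_lt.
have [kx|kx] := eqVneq #|children x| k.-1; last first.
  apply: (deg_bound p) => //; have := kids_lt xA; rewrite xu addn1.
  by move: kx; case: (k) => //= k' kx; rewrite !ltnS leq_eqVlt (negPf kx).
move: xb; rewrite inE xA xu kx eqxx /= => /forall_inPn[x'].
rewrite inE negbK => /and3P[x'A x'u /eqP px'] ux'.
pose q w := if w == x' then u else p w.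
(* Only [u] can gain a child, and [x] loses one. *)
have kids_q a : #|kids A u q a| + (a == x) <= #|children a| + (a == u).
  rewrite /kids; have [->|ax] := eqVneq a x; last first.
    rewrite addn0; have [->|au] := eqVneq a u.
      apply: (@leq_trans #|children u :|: [set x']|); last first.
        by rewrite (leq_trans (leq_card_setU _ _)) // cards1.
      apply/subset_leq_card/subsetP=> w; rewrite !inE /q.
      by case: (w == x'); rewrite ?orbT ?orbF.
    rewrite addn0; apply/subset_leq_card/subsetP=> w; rewrite !inE /q.
    by case: (w == x') => //; rewrite (eq_sym u) (negPf au) !andbF.
  rewrite (negPf xu) addn0 addn1; apply/proper_card/properP; split.
    apply/subsetP=> w; rewrite !inE /q.
    by case: (w == x') => //; rewrite (eq_sym u) (negPf xu) !andbF.
  by exists x'; rewrite !inE x'A x'u ?px' ?eqxx // /q eqxx (eq_sym u) (negPf xu).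
apply: (deg_bound q).
- split=> // w wA wu; rewrite /q; case: eqP => [->|_]; last exact: pP.
  rewrite uA adj_sym ux' du0; split=> //.
  by have [_ _ dlt] := pP x' x'A x'u; apply: leq_ltn_trans dlt.
- move=> a aA; have := kids_q a; have := kids_lt aA.
  by case: (a == u) => /=; lia.
- by have := kids_q x; have := kids_lt xA; rewrite eqxx (negPf xu) /=; lia.
Qed.

End HalfTree.

(** [P] is the set of blocked vertices of a breadth-first tree of the component of [u]. Each vertex
    has fewer than [k] children because [F] also gives it the edge to its parent or, at [u], the
    edge to [v]. *)
Lemma component_side G F F0 k u v : subrel F0 G -> subrel F0 F ->
  F u v -> ~~ F0 u v -> (forall x, degree F x <= k) ->
  let A := [set w | connect F0 u w] in
  exists P, [/\ P \subset A, u \notin P,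
    #|[set w in A | G u w]| + k.-1 * #|P| < #|A|
  & forall x, x \in A -> x \notin P -> exists F' : sgraph T,
    [/\ subrel F' G, forall a b, F' a b -> a \in A,
        forall a, a \in A -> connect F' u a,
        forall a, degree F' a <= k & degree F' x < k]].
Proof.
move=> F0G F0F Fuv F0uv Fdeg A.
have [p [d [du0 pP]]] := bfs_parent F0 u.
have rootedA (H : sgraph T) : subrel F0 H -> rooted H A u p d.
  move=> F0H; split=> //; first by rewrite inE connect0.
  move=> w; rewrite inE => uw wu; have [wp dlt] := pP w uw wu.
  rewrite inE (connect_trans uw (connect1 wp)); split=> //; exact: F0H.
have kids_lt x : x \in A -> #|kids A u p x| < k.
  move=> xA; apply: leq_trans (Fdeg x); apply/proper_card/properP; split.
    apply/subsetP => w; rewrite !inE => /and3P[uw wu /eqP <-].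
    by rewrite adj_sym; apply: F0F; have [] := pP w uw wu.
  have [->|xu] := eqVneq x u.
    exists v; rewrite ?inE //; apply/and3P => -[uv vu /eqP pv].
    by have [] := pP v uv vu; rewrite pv adj_sym (negPf F0uv).
  have xA' := xA; rewrite inE in xA'; have [xp dlt] := pP x xA' xu.
  exists (p x); rewrite inE ?(F0F _ _ xp) //.
  apply/and3P => -[]; rewrite inE => upx pxu /eqP ppx.
  by have [_] := pP _ upx pxu; rewrite ppx ltnNge ltnW.
exists (blocked G k A u p); split.
- by apply/subsetP => w; rewrite inE => /andP[].
- by rewrite inE eqxx /= andbF.
- exact: (card_blocked k (rootedA _ F0G)).
- by move=> x; exact: (unblocked_subgraph (rootedA _ F0G)).
Qed.

(** Adding the edge [x y] to both halves raises only the degrees of [x] and [y], where one edge was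
    spare. *)
Lemma join_sides G k A u v x y (FA FB : sgraph T) :
  G x y -> x \in A -> y \notin A ->
  subrel FA G -> (forall a b, FA a b -> a \in A) ->
  (forall a, a \in A -> connect FA u a) ->
  (forall a, degree FA a <= k) -> degree FA x < k ->
  subrel FB G -> (forall a b, FB a b -> a \notin A) ->
  (forall a, a \notin A -> connect FB v a) ->
  (forall a, degree FB a <= k) -> degree FB y < k ->
  bounded_spanning k G.
Proof.
move=> Gxy xA yA FAG FAA FAu FAk FAx FBG FBA FBv FBk FBy.
pose e a b := [|| FA a b, FB a b | (a == x) && (b == y)].
have eG a b : e a b -> G a b.
  by case/or3P => [/FAG|/FBG|/andP[/eqP-> /eqP->]].
have FAF : subrel FA (symgraph e).
  by move=> a b ab; rewrite /= /symgraph_rel (adj_neq (FAG _ _ ab)) /e ab.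
have FBF : subrel FB (symgraph e).
  by move=> a b ab; rewrite /= /symgraph_rel (adj_neq (FBG _ _ ab)) /e ab orbT.
have xyF : symgraph e x y.
  by rewrite /= /symgraph_rel (adj_neq Gxy) /e !eqxx !orbT.
exists (symgraph e); split.
- by move=> a b /andP[_ /orP[]/eG //]; rewrite adj_sym.
- have sub (H : sgraph T) : subrel H (symgraph e) ->
      subrel (connect H) (connect (symgraph e)).
    by move=> HF; apply: connect_sub => a b /HF/connect1.
  apply: (@gconnected_from _ u) => a.
  have [/FAu/(sub _ FAF)//|/FBv/(sub _ FBF) va] := boolP (a \in A).
  apply: connect_trans (sub _ FAF _ _ (FAu x xA)) _.
  apply: connect_trans (connect1 xyF) (connect_trans _ va).
  by rewrite connect_adj_sym; apply: (sub _ FBF); exact: FBv.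
- move=> a; have [aA|aA] := boolP (a \in A).
    have sub : [set b | symgraph e a b] \subset
        [set b | FA a b] :|: (if a == x then [set y] else set0).
      apply/subsetP => b; rewrite !inE /= /symgraph_rel /e (adj_sym FA b a) (adj_sym FB b a).
      have -> : FB a b = false by apply: contraTF aA => /FBA.
      rewrite (_ : a == y = false) ?andbF; last by apply: contraTF aA => /eqP->.
      case: (FA a b) => //=; case: (a == x); rewrite ?inE ?andbF ?orbF //.
      by case/andP.
    apply: leq_trans (subset_leq_card sub) _.
    apply: leq_trans (leq_card_setU _ _) _.
    have [->|_] := eqVneq a x; last by rewrite cards0 addn0; exact: FAk.
    by rewrite cards1 addn1.
  have sub : [set b | symgraph e a b] \subset
      [set b | FB a b] :|: (if a == y then [set x] else set0).
    apply/subsetP => b; rewrite !inE /= /symgraph_rel /e (adj_sym FA b a) (adj_sym FB b a).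
    have -> : FA a b = false by apply: contraNF aA => /FAA.
    rewrite (_ : a == x = false) /=; last by apply: contraNF aA => /eqP->.
    case: (FB a b) => //=; case: (a == y); rewrite ?inE ?andbT ?andbF //.
    by case/andP.
  apply: leq_trans (subset_leq_card sub) _.
  apply: leq_trans (leq_card_setU _ _) _.
  have [->|_] := eqVneq a y; last by rewrite cards0 addn0; exact: FBk.
  by rewrite cards1 addn1.
Qed.

(* Kano and Kishimoto: every edge of [G] across the cut left by [uv] in the
   tree has a blocked end, so at least [t] vertices are blocked, and each of
   them keeps [k - 1] vertices out of the neighbourhood of its root. *)
Lemma bounded_spanning_add_edge t k G u v : 2 <= k -> t_connected t G ->
  u != v -> ~~ G u v -> #|T| - (k - 2) * t - 1 <= degree G u + degree G v ->
  bounded_spanning k (add_edge G u v) -> bounded_spanning k G.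
Proof.
move=> k2 Gt uv nGuv deg_uv [F [FG Fconn Fk]].
set F0 := del_edge F u v.
have F0F : subrel F0 F := @del_edge_sub _ _ _.
have F0G : subrel F0 G.
  move=> a b; rewrite del_edgeE => /andP[/FG/orP[//|/andP[_]]].
  by move=> /orP[]/andP[-> ->]; rewrite ?orbT.
have F0uv : ~~ F0 u v by rewrite del_edgeE !eqxx andbF.
have [F0_uv|F0_uv] := boolP (connect F0 u v).
  exists F0; split=> //; first exact: gconnected_del_edge.
  by move=> x; apply: leq_trans (Fk x); exact: degree_sub.
have Fuv : F u v.
  apply: contraNT F0_uv => nFuv; apply: connect_sub (Fconn u v) => a b ab.
  apply: connect1; rewrite del_edgeE ab /=; apply: contra nFuv.
  by case/orP => /andP[/eqP<- /eqP<-] //; rewrite adj_sym.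
have [P [PA uP cardP extP]] := component_side F0G F0F Fuv F0uv Fk.
have Fvu : F v u by rewrite adj_sym.
have F0vu : ~~ F0 v u by rewrite adj_sym.
have [Q [QB vQ cardQ extQ]] := component_side F0G F0F Fvu F0vu Fk.
set A := [set w | connect F0 u w] in PA cardP extP.
(* Since [F] is connected, removing [uv] leaves just the components of [u] and [v]. *)
have BE : [set w | connect F0 v w] = ~: A.
  apply/setP => w; rewrite !inE; apply/idP/idP => [vw|].
    by apply: contra F0_uv => uw; apply: connect_trans uw _; rewrite connect_adj_sym.
  have : connect F0 u w || connect F0 v w.
    have cl : closed F [pred z | connect F0 u z || connect F0 v z].
      apply: intro_closed; first exact: connect_adj_sym.
      move=> a b ab; rewrite !inE.
      have [/orP[]/andP[_ /eqP->]|nab] := boolP ((a == u) && (b == v) || (a == v) && (b == u)).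
      - by rewrite connect0 orbT.
      - by rewrite connect0.
      have F0ab : F0 a b by rewrite del_edgeE ab.
      by case/orP => /connect_trans/(_ (connect1 F0ab)) ->; rewrite ?orbT.
    by have := closed_connect cl (Fconn u w); rewrite !inE connect0 => <-.
  by case/orP => // ->.
rewrite BE in QB cardQ extQ.
apply: contrapT => nspan.
have cross x y : x \in A -> y \notin A -> G x y -> (x \in P) || (y \in Q).
  move=> xA yA Gxy; apply/negP => /negP; rewrite negb_or => /andP[xP yQ].
  have yB : y \in ~: A by rewrite inE.
  have [FA [FAG FAA FAu FAk FAx]] := extP x xA xP.
  have [FB [FBG FBA FBv FBk FBy]] := extQ y yB yQ.
  apply: nspan; apply: (join_sides Gxy xA yA FAG FAA FAu FAk FAx FBG _ _ FBk FBy).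
    by move=> a b /FBA; rewrite inE.
  by move=> a aA; apply: FBv; rewrite inE.
have uA : u \in A by rewrite inE connect0.
have vA : v \notin A by rewrite inE.
have uQ : u \notin Q by apply: contraTN uA => /(subsetP QB); rewrite inE.
have vP : v \notin P by apply: contra vA => /(subsetP PA).
have tPQ : t <= #|P :|: Q|.
  apply: (t_connected_cut (A := A) (u := u) (v := v) Gt) => //.
  - by rewrite inE negb_or uP.
  - by rewrite inE negb_or vP.
  move=> x y xA yA /(cross x y xA yA); rewrite !inE.
  by case/orP => ->; rewrite ?orbT.
have degE w : degree G w = #|[set z in A | G w z]| + #|[set z in ~: A | G w z]|.
  rewrite /degree -(cardsID A); congr (_ + _); apply: eq_card => z.
    by rewrite !inE andbC.
  by rewrite !inE.
(* As [u] is not blocked, its neighbours across the cut all lie in [Q]. *)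
have duB : #|[set z in ~: A | G u z]| <= #|Q|.
  apply/subset_leq_card/subsetP => z; rewrite !inE => /andP[zA Guz].
  by have := cross u z uA; rewrite inE (negPf uP) => /(_ zA Guz).
have dvA : #|[set z in A | G v z]| <= #|P|.
  apply/subset_leq_card/subsetP => z; rewrite inE => /andP[zA Gvz].
  by have := cross z v zA vA; rewrite adj_sym Gvz (negPf vQ) orbF => /(_ isT).
have cardAB : #|A| + #|~: A| = #|T| := cardsC A.
have tPQ' := leq_trans tPQ (leq_card_setU P Q).
move: deg_uv; rewrite !degE.
case: k k2 {Fk extP extQ nspan} cardP cardQ => [|[|k]] // _ /= cardP cardQ.
(* With [k] now standing for $k-2$, the counts give $d(u)+d(v)\le |T|-2-k(|P|+|Q|)\le |T|-2-kt$, one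
   less than the closure threshold. *)
have : k * t <= k * (#|P| + #|Q|) by rewrite leq_mul2l tPQ' orbT.
rewrite !subSS subn0; move: cardP cardQ duB dvA cardAB; rewrite !mulSn mulnDr.
move: #|_| #|_| #|_| #|_| (k * t) => a1 a2 a3 a4 a5.
move: #|_| #|_| #|_| #|_| #|_| (k * _) (k * _) => a6 a7 a8 a9 a10 a11 a12.
clear; lia.
Qed.
End SpanningTrees.

(** * Closing the graph *)

Section Closure.
Variable T : finType.
Implicit Types (G H : sgraph T) (l k t : nat).

Definition degree_closed l G :=
  forall x y, x != y -> ~~ G x y -> degree G x + degree G y < l.

Variant closure_step_spec l G : sgraph T -> Prop :=
| ClosureStepAdd x y of x != y & ~~ G x y & l <= degree G x + degree G y :
    closure_step_spec l G (add_edge G x y)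
| ClosureStepStop of degree_closed l G : closure_step_spec l G G.

Lemma closure_stepP l G : closure_step_spec l G (closure_step l G).
Proof.
rewrite /closure_step; case: pickP => [[x y] /and3P[/= xy nxy lxy]|np].
  exact: ClosureStepAdd.
apply: ClosureStepStop => x y xy nxy; rewrite ltnNge.
by have := np (x, y); rewrite /= xy nxy /= => ->.
Qed.

Lemma add_edge_sub G x y : subrel G (add_edge G x y).
Proof. by move=> a b /= ab; rewrite /add_edge_rel ab. Qed.

Lemma iter_closure_step_sub l m G : subrel G (iter m (@closure_step l T) G).
Proof.
elim: m => [//|m IHm] a b /IHm; rewrite iterS.
by case: closure_stepP => // x y _ _ _; exact: add_edge_sub.
Qed.

Lemma gclosure_sub l G : subrel G (gclosure l G).
Proof. exact: iter_closure_step_sub. Qed.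

(** Until the process stops, each step adds an adjacent ordered pair, so after $|T|^2$ steps without
    stopping every pair would be adjacent. *)
Lemma gclosure_closed l G : degree_closed l (gclosure l G).
Proof.
pose E H := #|[set p : T * T | H p.1 p.2]|.
have step m : degree_closed l (iter m (@closure_step l T) G) \/
    m <= E (iter m (@closure_step l T) G).
  elim: m => [|m IHm]; first by right.
  rewrite iterS; case: closure_stepP => [x y xy nxy lxy|]; last by left.
  case: IHm => [/(_ x y xy nxy)|mE]; first by rewrite ltnNge lxy.
  right; apply: leq_ltn_trans mE _; apply/proper_card/properP; split.
    by apply/subsetP => p; rewrite !inE; exact: add_edge_sub.
  exists (x, y); rewrite !inE //=.
  by rewrite /add_edge_rel xy !eqxx orbT.
case: (step (#|T| ^ 2)) => // full x y xy; rewrite /gclosure.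
set H := iter _ _ _ in full *; suff -> : H x y by [].
have : [set p : T * T | H p.1 p.2] == [set: T * T].
  by rewrite eqEcard subsetT cardsT card_prod mulnn.
by move=> /eqP/setP/(_ (x, y)); rewrite !inE.
Qed.

Lemma bounded_spanning_gclosure t k G : 2 <= k -> t_connected t G ->
  bounded_spanning k (gclosure (#|T| - (k - 2) * t - 1) G) ->
  bounded_spanning k G.
Proof.
move=> k2 Gt; rewrite /gclosure; elim: (#|T| ^ 2) => [//|m IHm].
rewrite iterS; case: closure_stepP => // x y xy nxy lxy Hspan; apply: IHm.
apply: (bounded_spanning_add_edge k2 _ xy nxy lxy Hspan).
by apply: t_connected_sub Gt; exact: iter_closure_step_sub.
Qed.

(** The enumeration order of the vertices is a Hamiltonian path. *)
Lemma bounded_spanning_complete k G : 2 <= k ->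
  (forall x y, x != y -> G x y) -> bounded_spanning k G.
Proof.
move=> k2 Gcomplete.
pose r (x : T) : nat := enum_rank x.
have r_inj : injective r by move=> x y /val_inj/enum_rank_inj.
exists (symgraph (fun a b => r b == (r a).+1)); split.
- by move=> a b /andP[/Gcomplete].
- move=> x y; suff from z m : r z <= m ->
      forall w, r w = 0 -> connect (symgraph (fun a b => r b == (r a).+1)) w z.
    have T0 : 0 < #|T| by apply/card_gt0P; exists x.
    pose w := enum_val (Ordinal T0).
    have rw0 : r w = 0 by rewrite /r /w enum_valK.
    apply: (@connect_trans _ _ w); last exact: (from _ _ (leqnn _)).
    by rewrite connect_adj_sym; exact: (from _ _ (leqnn _)).
  elim: m z => [|m IHm] z.
    by rewrite leqn0 => /eqP rz w rw; rewrite (r_inj w z) // rw rz.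
  case E: (r z) => [|j] jm w rw; first by rewrite (r_inj w z) // rw E.
  have jT : j < #|T| by have := ltn_ord (enum_rank z); rewrite -/(r z) E; exact: ltnW.
  pose z' := enum_val (Ordinal jT).
  have rz' : r z' = j by rewrite /r /z' enum_valK.
  apply: connect_trans (IHm z' _ w rw) (connect1 _); first by rewrite rz'.
  rewrite /= /symgraph_rel rz' E eqxx andbT.
  by apply/eqP => zz; move: E; rewrite -zz rz'; lia.
- move=> a; apply: leq_trans k2.
  apply: (@leq_trans (#|[set b | r b == (r a).+1]| + #|[set b | r a == (r b).+1]|)).
    apply: leq_trans (leq_card_setU _ _); apply/subset_leq_card/subsetP => b.
    by rewrite !inE => /andP[].
  have one (B : {set T}) : {in B &, forall b c, r b = r c} -> #|B| <= 1.
    move=> rB; apply/card_le1_eqP => b c bB cB; apply: r_inj; exact: rB.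
  rewrite -[2]/(1 + 1) leq_add // one // => b c; rewrite !inE.
    by move=> /eqP -> /eqP ->.
  by move=> /eqP -> /eqP[].
Qed.

End Closure.

(** * Recognising $H^*$ *)

Section HstarIso.
Variables (T : finType) (H : sgraph T) (n k t : nat) (X I : {set T}).
Hypotheses (hT : #|T| = n) (hX : #|X| = t) (hI : #|I| = k * t - t + 1).
Hypotheses (k_gt0 : 0 < k) (hn : k * t < n) (dXI : [disjoint X & I]).
Hypothesis HE : forall x y,
  H x y = (x != y) && [|| x \in X, y \in X | (x \notin I) && (y \notin I)].

Lemma ord_enum_set (A : {set T}) m : #|A| = m ->
  exists2 f : 'I_m -> T, injective f & forall i, f i \in A.
Proof.
by move=> <-; exists enum_val; [exact: enum_val_inj | exact: enum_valP].
Qed.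

(** [X] plays $K_t$, [I] the isolated vertices and the rest the large clique. The map [g] from the
    vertices of $H^*$ is injective, hence bijective by cardinality. *)
Lemma giso_Hstar : giso H (Hstar n k t).
Proof.
have tk : t <= k * t by rewrite leq_pmull.
have cardC : #|~: (X :|: I)| = n - k * t - 1.
  have := cardsC (X :|: I); rewrite cardsU (disjoint_setI0 dXI) cards0 hX hI hT.
  by lia.
have [fX fX_inj fXP] := ord_enum_set hX.
have [fC fC_inj fCP] := ord_enum_set cardC.
have [fI fI_inj fIP] := ord_enum_set hI.
have fXI i : fX i \notin I by have := disjointFr dXI (fXP i) => ->.
have fIX i : fI i \notin X by have := disjointFl dXI (fIP i) => ->.
have fCXI i : (fC i \notin X) && (fC i \notin I).
  by have := fCP i; rewrite !inE negb_or.
have fCX i : fC i \notin X by case/andP: (fCXI i).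
have fCI i : fC i \notin I by case/andP: (fCXI i).
pose U := ('I_t + ('I_(n - k * t - 1) + 'I_(k * t - t + 1) * 'I_1))%type.
pose g (w : U) := match w with
  | inl i => fX i | inr (inl i) => fC i | inr (inr q) => fI q.1 end.
have neq (A : {set T}) (x y : T) : x \in A -> y \notin A -> x = y -> False.
  by move=> xA yA xy; rewrite -xy xA in yA.
have g_inj : injective g.
  move=> [i|[i|[i i']]] [j|[j|[j j']]] //=.
  - by move=> /fX_inj ->.
  - by move/(neq _ _ _ (fXP i) (fCX j)).
  - by move/(neq _ _ _ (fXP i) (fIX j)).
  - by move/esym/(neq _ _ _ (fXP j) (fCX i)).
  - by move=> /fC_inj ->.
  - by move/esym/(neq _ _ _ (fIP j) (fCI i)).
  - by move/esym/(neq _ _ _ (fXP j) (fIX i)).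
  - by move/(neq _ _ _ (fIP i) (fCI j)).
  - by move=> /fI_inj ->; rewrite (ord1 i') (ord1 j').
have g_bij : bijective g.
  apply: inj_card_bij => //.
  by rewrite !card_sum card_prod !card_ord hT; lia.
have gE u v : H (g u) (g v) = Hstar n k t u v.
  rewrite HE (inj_eq g_inj).
  case: u v => [i|[i|[i i']]] [j|[j|[j j']]] //=; rewrite ?fXP ?orbT ?andbT //.
  - by rewrite (negPf (fCX i)) (negPf (fCX j)) (fCI i) (fCI j) /= andbT.
  - by rewrite (negPf (fCX i)) (negPf (fIX j)) (fIP j) /= andbF.
  - by rewrite (negPf (fIX i)) (negPf (fCX j)) (fIP i).
  - rewrite (negPf (fIX i)) (negPf (fIX j)) (fIP i) /= andbF.
    by rewrite /copies_rel /= (ord1 i') (ord1 j') eqxx andbF.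
case: g_bij => g' gK g'K; exists g'; first by exists g.
by move=> x y; rewrite -gE !g'K.
Qed.

End HstarIso.

(** * Closed graphs with few missing edges *)

(* With a = (k - 2) t, the last hypothesis says D <= 2 g.  The lower bound for D
   increases with b, and at b = i + a + 1 it is a concave function of i whose
   value at i = t + 1 is 2 g + 2. *)
Lemma extremal_int_arith (a t n i b D : int) :
  (0 <= a -> 1 <= t -> 7 * a + 12 * t + 4 <= n ->
   t + 1 <= i -> i + a + 1 <= b -> b <= n - 1 - i ->
   b * (2 * (n - 1 - i) + 1 - b) <= D ->
   D + (a + t) ^+ 2 + 5 * (a + 2 * t) + 10
     <= 2 * (n - 1 - t) * (a + t + 1) + 2 * n + 3 * t ->
   False)%R.
Proof.
move=> a0 t1 nlarge ti bi bn Dlow Dup.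
(* [h1] is the lower bound at [b] minus its value at $b=i+a+1$; [h2] is that value at [i] minus the
   one at $i=t+1$, both factored. *)
have h1 : (0 <= (b - (i + a + 1)) * (2 * (n - 1 - i) + 1 - b - (i + a + 1)))%R.
  by apply: mulr_ge0; lia.
have h2 : (0 <= (i - t - 1) * (2 * n - 3 * i - 3 * t - 4 * a - 8))%R.
  by apply: mulr_ge0; lia.
nia.
Qed.

(** Here [bu] and [b] are the larger and the smaller codegree of the chosen pair, and $i=n-1-bu$; a
    value of [bu] other than $n-1-t$ means $i\ge t+1$. *)
Lemma extremal_arith (k t n bu b D : nat) : 1 <= t -> 2 <= k ->
  (7 * k - 2) * t + 4 <= n -> bu + t < n -> b <= bu ->
  n + (k - 2) * t <= bu + b ->
  b * bu + (bu + 1 - b) * b <= D ->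
  D + (k - 1) ^ 2 * t ^ 2 + 5 * k * t + 10
    <= 2 * (n - 1 - t) * ((k - 1) * t + 1) + 2 * n + 3 * t ->
  bu = n - 1 - t.
Proof.
move=> t1 k2 nlarge but bbu sumb Dlow Dup; apply/eqP; apply: contraT => /eqP neq.
exfalso.
have [c kE] : exists c, k = c + 2 by exists (k - 2); rewrite subnK.
subst k; rewrite addnK in sumb.
have e1 : (7 * (c + 2) - 2) * t = 7 * (c * t) + 12 * t
  by rewrite (_ : 7 * (c + 2) - 2 = 7 * c + 12) ?mulnDl ?mulnA //; lia.
have e2 : c + 2 - 1 = c + 1 by lia.
rewrite e2 in Dup; rewrite e1 in nlarge.
apply: (@extremal_int_arith (c * t)%:Z t n (n%:Z - 1 - bu%:Z)%R b D); try lia.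
Qed.

(** What remains of $2g$ for the codegrees outside [I], once the pairs meeting [I] are subtracted;
    the terms quadratic in $(k-1)t$ cancel. *)
Lemma sum_inner_arith (k t n D Q : nat) : 2 <= k -> (7 * k - 2) * t + 4 <= n ->
  1 <= t ->
  ((k - 1) * t + 1) * (n - 1 - t) +
    ((k - 1) * t + 1) * (n - 1 - t + 1 - ((k - 1) * t + 1)) + Q <= D ->
  D + (k - 1) ^ 2 * t ^ 2 + 5 * k * t + 10
    <= 2 * (n - 1 - t) * ((k - 1) * t + 1) + 2 * n + 3 * t ->
  Q <= 2 * (n + t - 2 * (k * t) - 5).
Proof.
move=> k2 nlarge t1; have [c kE] : exists c, k = c + 2 by exists (k - 2); rewrite subnK.
subst k; have e1 : (7 * (c + 2) - 2) * t = 7 * (c * t) + 12 * t.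
  by rewrite (_ : 7 * (c + 2) - 2 = 7 * c + 12) ?mulnDl ?mulnA //; lia.
have e2 : c + 2 - 1 = c + 1 by lia.
rewrite -expnMn e2 (mulnDl c 1 t) mul1n.
have e3 : 5 * (c + 2) * t = 5 * (c * t) + 10 * t by rewrite -mulnA mulnDl mulnDr mulnA; lia.
have e4 : (c + 2) * t = c * t + 2 * t by rewrite mulnDl.
rewrite e3 e4; rewrite e1 in nlarge; move: (c * t) nlarge => a nlarge.
have [m nE] : exists m, n = m + a + 2 * t + 1 by exists (n - a - 2 * t - 1); lia.
subst n.
have -> : m + a + 2 * t + 1 - 1 - t = m + a + t by lia.

have -> : m + a + t + 1 - (a + t + 1) = m by lia.
nia.
Qed.

(** * Degree sums *)

Section DegreeSums.
Variable T : finType.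
Implicit Types (G H : sgraph T) (I W : {set T}).

Lemma card_set_in_sum W (P : pred T) :
  #|[set y in W | P y]| = \sum_(y in W) P y.
Proof.
rewrite -sum1_card (eq_bigl (fun y => (y \in W) && P y)); last first.
  by move=> y; rewrite inE.
by rewrite big_mkcondr; apply: eq_bigr => y _; case: (P y).
Qed.

Lemma degree_sum G x : degree G x = \sum_y G x y.
Proof.
rewrite /degree -sum1_card big_mkcond; apply: eq_bigr => y _.
by rewrite inE; case: (G x y).
Qed.

Lemma degree_compl G x : degree G x + degree (compl G) x + 1 = #|T|.
Proof.
rewrite -(cardsC [set y | G x y]) -addnA; congr (_ + _).
rewrite (_ : ~: _ = x |: [set y | compl G x y]).
  by rewrite cardsU1 inE /= /compl_rel eqxx addnC.
apply/setP => y; rewrite !inE /= /compl_rel (eq_sym x).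
by have [->|] := eqVneq y x; rewrite ?adj_irr.
Qed.

Lemma degree_split G W x :
  degree G x = \sum_(y in W) G x y + \sum_(y in ~: W) G x y.
Proof.
rewrite degree_sum (bigID (mem W)) /=; congr (_ + _).
by apply: eq_bigl => y; rewrite inE.
Qed.

(** A vertex of [I] has at most $|I|-1$ neighbours in [I], so at least $m+1-|I|$ outside; these
    edges are counted again from their outer ends. *)
Lemma sum_degree_ge G I m : {in I, forall x, m <= degree G x} ->
  #|I| * m + #|I| * (m + 1 - #|I|) +
  \sum_(x in ~: I) \sum_(y in ~: I) G x y <= \sum_x degree G x.
Proof.
move=> Im; rewrite [leqRHS](bigID (mem I)) /= -addnA; apply: leq_add.
  by rewrite -sum_nat_const; exact: leq_sum.
rewrite [leqRHS](eq_bigl (fun x => x \in ~: I)); last by move=> x; rewrite inE.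
rewrite (eq_bigr _ (fun x _ => degree_split G I x)) big_split /= leq_add2r.
rewrite exchange_big /= -sum_nat_const; apply: leq_sum => x xI.
rewrite (eq_bigr (fun y => G x y : nat)); last by move=> y _; rewrite adj_sym.
have := Im x xI; rewrite (degree_split G I).
suff : \sum_(y in I) G x y < #|I| by lia.
rewrite -card_set_in_sum; apply/proper_card/properP; split.
  by apply/subsetP => y; rewrite inE => /andP[].
by exists x => //; rewrite inE adj_irr andbF.
Qed.

(** Twice the number of edges within [W] meeting [w] or [w']; the edge [w w'] is counted in both
    sums, whence the 2. *)
Lemma sum_inner_degree_ge G W w w' : w \in W -> w' \in W -> G w w' ->
  2 * (\sum_(y in W) G w y + \sum_(y in W) G w' y) <=
  \sum_(x in W) \sum_(y in W) G x y + 2.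
Proof.
move=> wW w'W ww'; have neq := adj_neq ww'.
pose r x := \sum_(y in W | (y != w) && (y != w')) G x y.
have split2 (F : T -> nat) : \sum_(y in W) F y =
    F w + (F w' + \sum_(y in W | (y != w) && (y != w')) F y).
  rewrite (bigD1 w) //= (bigD1 w') /=; last by rewrite w'W eq_sym.
  by congr (_ + (_ + _)); apply: eq_bigl => y; rewrite andbA.
have wE : \sum_(y in W) G w y = 1 + r w by rewrite split2 adj_irr ww'.
have w'E : \sum_(y in W) G w' y = 1 + r w'.
  by rewrite split2 adj_irr adj_sym ww'.
rewrite [in leqRHS]split2 wE w'E.
suff : r w + r w' <= \sum_(x in W | (x != w) && (x != w')) \sum_(y in W) G x y.
  by lia.
rewrite /r -big_split; apply: leq_sum => x _; rewrite split2.
by rewrite (adj_sym G x w) (adj_sym G x w') addnA leq_addr.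
Qed.

(** The neighbours of [v] have degree at least that of [u]; among [u] and its neighbours, those not
    adjacent to [v] still have degree at least that of [v]. *)
Lemma sum_degree_max_pair G u v :
  degree G v <= degree G u ->
  (forall x, G v x -> degree G u <= degree G x) ->
  (forall x, G u x -> degree G v <= degree G x) ->
  degree G v * degree G u + (degree G u + 1 - degree G v) * degree G v
    <= \sum_x degree G x.
Proof.
move=> dvu dv du; pose L := [set x | G v x]; pose M := u |: [set x | G u x].
rewrite (bigID (mem L)) /= leq_add //.
  rewrite -[degree G v in leqLHS]/(#|L|) -sum_nat_const.
  by apply: leq_sum => x; rewrite inE => /dv.
have cardM : #|M| = degree G u + 1 by rewrite cardsU1 inE adj_irr addnC.
apply: (@leq_trans (#|M :\: L| * degree G v)).
  rewrite leq_mul2r -cardM cardsD leq_sub2l ?orbT //.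
  by rewrite subset_leq_card // subsetIr.
rewrite -sum_nat_const [leqRHS](bigID (mem M)) /=.
apply: leq_trans (leq_addr _ _).
rewrite (eq_bigl (fun x => (x \notin L) && (x \in M))); last first.
  by move=> x; rewrite in_setD.
by apply: leq_sum => x /andP[_]; rewrite !inE => /orP[/eqP->|/du].
Qed.

(** The sum of squares is the sum over ordered adjacent pairs of the degree of either end; adding
    both versions gives at least [m] per pair. *)
Lemma sum_degree_sqr_ge G m :
  (forall x y, G x y -> m <= degree G x + degree G y) ->
  m * \sum_x degree G x <= 2 * \sum_x degree G x ^ 2.
Proof.
move=> Gm.
have sqrE : \sum_x degree G x ^ 2 = \sum_x \sum_y G x y * degree G x.
  apply: eq_bigr => x _; rewrite -mulnn {1}degree_sum big_distrl //.
have sqrE' : \sum_x degree G x ^ 2 = \sum_x \sum_y G x y * degree G y.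
  rewrite sqrE exchange_big; apply: eq_bigr => x _; apply: eq_bigr => y _.
  by rewrite adj_sym.
rewrite mul2n -addnn {1}sqrE sqrE' -big_split big_distrr /=; apply: leq_sum => x _.
rewrite -big_split degree_sum big_distrr /=; apply: leq_sum => y _.
by case Gxy: (G x y); rewrite ?muln0 // muln1 !mul1n -?degree_sum; exact: Gm.
Qed.

End DegreeSums.

Lemma codegree_sum (T : finType) (H : sgraph T) a x y :
  degree_closed (#|T| - a - 1) H -> compl H x y ->
  #|T| + a <= degree (compl H) x + degree (compl H) y.
Proof.
move=> Hclosed /andP[xy nxy]; have := Hclosed x y xy nxy.
have := degree_compl H x; have := degree_compl H y; lia.
Qed.

(** * The structure of the extremal closed graph *)

Section Extremal.
Variables (T : finType) (H : sgraph T) (n k t : nat).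
Hypotheses (ht : 1 <= t) (hk : 2 <= k) (hn : (7 * k - 2) * t + 4 <= n).
Hypotheses (hT : #|T| = n) (Ht : t_connected t H).
Hypothesis Hclosed : degree_closed (n - (k - 2) * t - 1) H.
(** This is $2e(H')\le 2g$, cleared of fractions and negative terms. *)
Hypothesis Hsum : \sum_x degree (compl H) x
    + (k - 1) ^ 2 * t ^ 2 + 5 * k * t + 10
  <= 2 * (n - 1 - t) * ((k - 1) * t + 1) + 2 * n + 3 * t.

Local Notation codegree x := (degree (compl H) x).

Lemma codegreeE x : degree H x + codegree x + 1 = n.
Proof. by rewrite degree_compl. Qed.

Lemma low_degree_set : (exists x y, compl H x y) ->
  exists I : {set T}, #|I| = (k - 1) * t + 1 /\ {in I, forall x, degree H x = t}.
Proof.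
move=> [x0 [y0 xy0]].
pose P (q : T * T) := compl H q.1 q.2.
have [u [v [uv dvu uv_max]]] : exists u v, [/\ compl H u v,
    codegree v <= codegree u
  & forall x y, compl H x y -> codegree u + codegree v <= codegree x + codegree y].
  have P0 : P (x0, y0) by [].
  case: (arg_minnP (fun q => codegree q.1 + codegree q.2) P0) => [[u v]].
  rewrite /P => uv uv_min.
  have [vu|/ltnW uv'] := leqP (codegree v) (codegree u).
    by exists u, v; split=> // x y xy; apply: (uv_min (x, y)).
  exists v, u; split=> //; first by rewrite (adj_sym (compl H)).
  by move=> x y xy; rewrite addnC; apply: (uv_min (x, y)).
have degree_ge x y : compl H x y -> t <= degree H x.
  by case/andP; exact: t_connected_min_degree.
have du x : compl H v x -> codegree u <= codegree x.
  by move=> /uv_max; rewrite addnC leq_add2l.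
have dv x : compl H u x -> codegree v <= codegree x.
  by move=> /uv_max; rewrite leq_add2l.
have low := sum_degree_max_pair dvu du dv.
have sum_uv : n + (k - 2) * t <= codegree u + codegree v.
  by rewrite -hT; apply: codegree_sum uv; rewrite hT.
have uE : codegree u = n - 1 - t.
  apply: (extremal_arith ht hk hn _ dvu sum_uv low Hsum).
  have := codegreeE u; have := degree_ge u v uv; lia.
(* From $n+a\le d_{H'}(u)+d_{H'}(v)$ and $d_{H'}(u)=n-1-t$. *)
have sv : (k - 1) * t + 1 <= #|[set x | compl H v x]|.
  move: sum_uv; rewrite -/(codegree v) uE.
  have : (k - 1) * t = (k - 2) * t + t by rewrite -mulSnr; congr (_ * _); lia.
  have := codegreeE u; lia.
have /card_geqP[s [s_uniq s_size s_sub]] := sv.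
exists [set x in s]; split.
  by rewrite cardsE (card_uniqP s_uniq).
(* A non-neighbour of [v] has codegree at least $n-1-t$ by the choice of the pair, and degree at
   least $t$ by connectivity. *)
move=> x; rewrite inE => /s_sub; rewrite inE => vx.
have := degree_ge x v; rewrite adj_sym => /(_ vx).
have := du x vx; have := codegreeE x; have := codegreeE u; lia.
Qed.

Lemma closed_extremal : (exists x y, compl H x y) -> giso H (Hstar n k t).
Proof.
move=> Hnc; have [I [cardI degI]] := low_degree_set Hnc.
have sE : (k - 1) * t = (k - 2) * t + t by rewrite -mulSnr; congr (_ * _); lia.
have sE' : k * t = (k - 2) * t + 2 * t by rewrite -mulnDl subnK.
have nE : 7 * ((k - 2) * t) + 12 * t + 4 <= n.
  move: hn; rewrite (_ : 7 * k - 2 = 7 * (k - 2) + 12) ?mulnDl ?mulnA //; lia.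
have codegI : {in I, forall x, codegree x = n - 1 - t}.
  by move=> x xI; have := codegreeE x; rewrite degI //; lia.
pose q x := \sum_(y in ~: I) compl H x y.
have Qbound : \sum_(x in ~: I) q x <= 2 * (n + t - 2 * (k * t) - 5).
  have : {in I, forall x, n - 1 - t <= codegree x} by move=> x /codegI ->.
  by move=> /sum_degree_ge; rewrite cardI => /sum_inner_arith; apply.
have degree_out w : w \notin I -> n - ((k - 1) * t + 1) <= degree H w + q w + 1.
  move=> wI; have := codegreeE w; rewrite (degree_split (compl H) I) -/(q w).
  have : \sum_(y in I) compl H w y <= #|I|.
    by rewrite -card_set_in_sum; apply/subset_leq_card/subsetP => y; rewrite inE => /andP[].
  by rewrite cardI; lia.
(* For nonadjacent [w], [w'] the bound on the inner sum yields $q(w)+q(w')\le n+t-2kt-4$, hence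
   $d(w)+d(w')\ge n+t$, against closedness. *)
have clique w w' : w \notin I -> w' \notin I -> w != w' -> H w w'.
  move=> wI w'I ww'; apply: contraT => nww'.
  have cww' : compl H w w' by rewrite /= /compl_rel ww'.
  have wW : w \in ~: I by rewrite inE.
  have w'W : w' \in ~: I by rewrite inE.
  have := sum_inner_degree_ge wW w'W cww'; rewrite -/(q w) -/(q w').
  rewrite -/q; have := degree_out w wI; have := degree_out w' w'I.
  have := Hclosed ww' nww'; move: Qbound; rewrite sE' sE.
  move: (\sum_(x in _) _) (q w) (q w') (degree H w) (degree H w') ((k - 2) * t) nE.
  by clear; move=> *; exfalso; lia.
(* Adjacent to all other vertices outside [I] and to [x], [w] has degree at least $n-s$; with
   $d(y)=t$ the sum reaches the threshold $n-a-1$ exactly. *)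
have all_or_none w x y : w \notin I -> x \in I -> y \in I -> H w x -> H w y.
  move=> wI xI yI wx; apply: contraT => nwy.
  have wy : w != y by apply: contraNneq wI => ->.
  have q0 : q w = 0.
    rewrite /q big1 // => z; rewrite inE => zI; rewrite /= /compl_rel.
    by have [//|wz] := eqVneq w z; rewrite clique.
  have : \sum_(z in I) compl H w z < #|I|.
    rewrite -card_set_in_sum; apply/proper_card/properP; split.
      by apply/subsetP => z; rewrite inE => /andP[].
    by exists x => //; rewrite inE /= /compl_rel wx !andbF.
  have := codegreeE w; rewrite (degree_split (compl H) I) -/(q w) q0 cardI.
  have := Hclosed wy nwy; rewrite (degI y yI) sE.
  move: (\sum_(x in _) _) (degree H w) ((k - 2) * t) nE.
  by clear; move=> *; exfalso; lia.
have [x0 x0I] : exists x, x \in I by apply/card_gt0P; rewrite cardI addn1.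
pose X := [set w in ~: I | H w x0].
have XN x : x \in I -> X \subset [set w | H x w].
  move=> xI; apply/subsetP => w; rewrite !inE => /andP[wI wx0].
  by rewrite adj_sym; exact: all_or_none x0I xI wx0.
have Xle : #|X| <= t by rewrite -(degI x0 x0I) subset_leq_card // XN.
have dXI : [disjoint X & I].
  rewrite -setI_eq0 -subset0; apply/subsetP => w; rewrite !inE.
  by case/andP => /andP[/negPf ->].
have [w wXI] : exists w, w \in ~: (X :|: I).
  apply/card_gt0P; have := cardsC (X :|: I).
  rewrite cardsU (disjoint_setI0 dXI) cards0 cardI hT.
  by move: Xle nE; rewrite sE; lia.
have [wX wI] : w \notin X /\ w \notin I by apply/norP; move: wXI; rewrite !inE.
(* Every edge leaving [I] ends in [X], so [X] separates [x0] from [w]. *)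
have cardX : #|X| = t.
  apply/eqP; rewrite eqn_leq Xle.
  apply: (t_connected_cut (A := I) (u := x0) (v := w) Ht) => //.
    by rewrite !inE x0I.
  move=> x y xI yI xy; apply/orP; right; rewrite !inE yI /=.
  by apply: (all_or_none _ x) => //; rewrite adj_sym.
have NX x : x \in I -> [set w | H x w] = X.
  move=> xI; apply/esym/eqP; rewrite eqEcard XN // cardX.
  by have := degI x xI; rewrite /degree => ->; rewrite leqnn.
have HIX x y : x \in I -> H x y = (y \in X).
  by move=> xI; rewrite -(NX x xI) inE.
apply: (giso_Hstar (X := X) (I := I)) => //.
- by rewrite cardI mulnBl mul1n.
-  exact: ltnW.
- by rewrite sE'; lia.
- move=> x y; have [<-|xy] := eqVneq x y; first by rewrite adj_irr.
  have [xI|xI] := boolP (x \in I).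
    by rewrite HIX // (disjointFl dXI xI) /= orbF.
  have [yI|yI] := boolP (y \in I).
    by rewrite adj_sym HIX // (disjointFl dXI yI) /= orbF.
  by rewrite clique // !orbT.
Qed.

End Extremal.

(** * The spectral radius and the degrees *)

Section SymmetricSpectrum.
Local Open Scope ring_scope.
Local Open Scope sesquilinear_scope.
Variable R : realType.

Lemma unitary_diag_form n (P : 'M[R[i]]_n) (D x : 'rV[R[i]]_n) :
  (x *m (P^t* *m diag_mx D *m P) *m x^t*) 0 0 =
  \sum_i D 0 i * `|(x *m P^t*) 0 i| ^+ 2.
Proof.
set y := x *m P^t*.
have -> : x *m (P^t* *m diag_mx D *m P) *m x^t* =
          y *m diag_mx D *m y^t*.
  by rewrite /y !trmx_mul !map_mxM /= trmxCK !mulmxA.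
rewrite mxE; apply: eq_bigr => i _.
by rewrite mul_mx_diag !mxE normCK mulrAC mulrC mulrA.
Qed.

Lemma unitary_diag_sqr n (P D : 'M[R[i]]_n) : P \is unitarymx ->
  P^t* *m D *m P *m (P^t* *m D *m P) = P^t* *m (D *m D) *m P.
Proof. by move=> P_unit; rewrite !mulmxA (mulmxtVK _ P_unit). Qed.

(** Unitary diagonalisation over [R[i]], where the eigenvalues are real. [N x i] is the squared
    modulus of a coordinate of [x] in the eigenbasis, which keeps the statement over [R]. *)
Lemma symmetric_spectrum n (A : 'M[R]_n) : A^T = A ->
  exists (lam : 'I_n -> R) (N : 'rV[R]_n -> 'I_n -> R),
  [/\ forall i, eigenvalue A (lam i),
      forall x i, 0 <= N x i,
      forall x, (x *m x^T) 0 0 = \sum_i N x i,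
      forall x, (x *m A *m x^T) 0 0 = \sum_i lam i * N x i
    & forall x, (x *m A *m (A *m x^T)) 0 0 = \sum_i lam i ^+ 2 * N x i].
Proof.
move=> Asym; pose toC := real_complex R; pose Ac := map_mx toC A.
have Ac_herm : Ac \is hermsymmx.
  apply: realsym_hermsym.
    by apply/is_hermitianmxP; rewrite expr0 scale1r map_mx_id // map_trmx Asym.
  by apply/mxOverP => i j; rewrite mxE complex_real.
set P := spectralmx Ac; set D := spectral_diag Ac.
have P_unit : P \is unitarymx := spectral_unitarymx Ac.
have AcE : Ac = P^t* *m diag_mx D *m P.
  rewrite -invmx_unitary //; apply/orthomx_spectralP.
  exact: hermitian_normalmx.
have PPt : P *m P^t* = 1%:M by apply/unitarymxP.
have PtP : P^t* *m P = 1%:M by rewrite -invmx_unitary // mulVmx ?unitarymx_unit.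
pose lam i := complex.Re (D 0 i).
have DE i : D 0 i = toC (lam i).
  have /mxOverP/(_ 0 i) := hermitian_spectral_diag_real Ac_herm.
  by move=> /RRe_real <-.
pose N (x : 'rV[R]_n) i :=
  complex.Re ((map_mx toC x *m P^t*) 0 i) ^+ 2 +
  complex.Im ((map_mx toC x *m P^t*) 0 i) ^+ 2.
have NE x i : `|(map_mx toC x *m P^t*) 0 i| ^+ 2 = toC (N x i).
  by rewrite -add_Re2_Im2.
have xtE (x : 'rV[R]_n) : (map_mx toC x)^t* = map_mx toC x^T.
  by apply/matrixP => i j; rewrite !mxE; apply: (conjc_real (x j i)).
exists lam, N; split.
- move=> i; suff: eigenvalue Ac (D 0 i).
    rewrite !eigenvalue_root_char DE /Ac -map_char_poly.
    by rewrite (fmorph_root (real_complex R)).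
  apply/eigenvalueP; exists (row i P).
    rewrite -row_mul AcE !mulmxA PPt mul1mx row_mul.
    rewrite (_ : row i (diag_mx D) = D 0 i *: delta_mx 0 i).
      by rewrite -scalemxAl -rowE.
    by apply/rowP => j; rewrite !mxE eqxx /= mulr_natr eq_sym.
  apply/negP => /eqP Pi0.
  have := congr1 (fun M : 'M_n => row i M) PPt.
  rewrite row_mul Pi0 mul0mx => /rowP/(_ i); rewrite !mxE eqxx /= => /eqP.
  by rewrite eq_sym oner_eq0.
- by move=> x i; rewrite addr_ge0 ?sqr_ge0.
- move=> x; apply: (@complexI R).
  have := unitary_diag_form P (const_mx 1) (map_mx toC x).
  rewrite diag_const_mx mulmx1 PtP mulmx1 xtE -map_mxM mxE => ->.
  by rewrite rmorph_sum; apply: eq_bigr => i _; rewrite mxE mul1r NE.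
- move=> x; apply: (@complexI R).
  have := unitary_diag_form P D (map_mx toC x).
  rewrite -AcE xtE -!map_mxM mxE => ->.
  by rewrite rmorph_sum; apply: eq_bigr => i _; rewrite DE NE -rmorphM.
- move=> x; apply: (@complexI R).
  have := unitary_diag_form P (\row_i D 0 i ^+ 2) (map_mx toC x).
  have -> : diag_mx (\row_i D 0 i ^+ 2) = diag_mx D *m diag_mx D.
    by rewrite mulmx_diag; congr diag_mx; apply/rowP => j; rewrite !mxE expr2.
  have -> : P^t* *m (diag_mx D *m diag_mx D) *m P = Ac *m Ac.
    by rewrite AcE unitary_diag_sqr.
  rewrite xtE -!map_mxM mxE mulmxA -!mulmxA => ->.
  rewrite rmorph_sum; apply: eq_bigr => i _.
  by rewrite mxE DE NE -rmorphXn -rmorphM.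
Qed.

Lemma row_normsq_gt0 n (v : 'rV[R]_n) : v != 0 -> 0 < (v *m v^T) 0 0.
Proof.
move=> v0; rewrite mxE lt_neqAle eq_sym; apply/andP; split; last first.
  by apply: sumr_ge0 => i _; rewrite mxE -expr2 sqr_ge0.
apply: contra v0 => /eqP/psumr_eq0P v0; apply/eqP/rowP => i.
have /v0/(_ i isT)/eqP : forall i, true -> 0 <= v 0 i * v^T i 0.
  by move=> j _; rewrite mxE -expr2 sqr_ge0.
by rewrite !mxE mulf_eq0 orbb => /eqP.
Qed.

(** The Perron-Frobenius argument: taking absolute values in an eigenvector cannot lower the modulus
    of its Rayleigh quotient, so the largest eigenvalue bounds all others in modulus. *)
Lemma nonneg_symmetric_spectral_radius n (A : 'M[R]_n.+1) : A^T = A ->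
  (forall i j, 0 <= A i j) ->
  exists2 r, largest_eigenvalue A r & 0 <= r /\
    forall x : 'rV[R]_n.+1, (x *m A *m (A *m x^T)) 0 0 <= r ^+ 2 * (x *m x^T) 0 0.
Proof.
move=> Asym Age0.
have [lam [N [lam_eig N_ge0 NE AE A2E]]] := symmetric_spectrum Asym.
pose i0 := [arg max_(i > ord0) lam i]%O.
have lam_max i : lam i <= lam i0.
  by rewrite /i0; case: arg_maxP => // j _ /(_ i isT).
have rayleigh (x : 'rV[R]_n.+1) : (x *m A *m x^T) 0 0 <= lam i0 * (x *m x^T) 0 0.
  by rewrite AE NE mulr_sumr; apply: ler_sum => i _; rewrite ler_wpM2r.
have abs_le i : `|lam i| <= lam i0.
  have /eigenvalueP[v vA v0] := lam_eig i.
  pose w : 'rV[R]_n.+1 := map_mx Num.norm v.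
  have wwE : (w *m w^T) 0 0 = (v *m v^T) 0 0.
    by rewrite !mxE; apply: eq_bigr => j _; rewrite !mxE -!expr2 real_normK ?num_real.
  rewrite -(ler_pM2r (row_normsq_gt0 v0)) -{2}wwE.
  apply: le_trans (rayleigh w).
  rewrite -{1}(ger0_norm (ltW (row_normsq_gt0 v0))) -normrM.
  have -> : lam i * (v *m v^T) 0 0 = (v *m A *m v^T) 0 0.
    by rewrite vA -scalemxAl [in RHS]mxE.
  rewrite !mxE; apply: le_trans (ler_norm_sum _ _ _) _; apply: ler_sum => j _.
  rewrite !mxE normrM; apply: ler_wpM2r => //.
  apply: le_trans (ler_norm_sum _ _ _) _; apply: ler_sum => k _.
  by rewrite !mxE normrM (ger0_norm (Age0 _ _)).
exists (lam i0); first split.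
- exact: lam_eig.
- move=> a /eigenvalueP[v vA v0].
  rewrite -(ler_pM2r (row_normsq_gt0 v0)) (le_trans _ (rayleigh v)) //.
  by rewrite vA -scalemxAl [leRHS]mxE.
split; first exact: le_trans (normr_ge0 _) (abs_le i0).
move=> x; rewrite A2E NE mulr_sumr; apply: ler_sum => i _.
rewrite ler_wpM2r // -real_normK ?num_real // lerXn2r ?nnegrE //.
exact: le_trans (normr_ge0 _) (abs_le i0).
Qed.

Lemma adjmx_row_sum (T : finType) (G : sgraph T) (j : 'I_#|T|) :
  ((const_mx 1 : 'rV_#|T|) *m adjmx R G) 0 j = (degree G (enum_val j))%:R.
Proof.
rewrite mxE /degree -sum1_card natr_sum [in RHS]big_mkcond /=.
rewrite [in RHS](reindex (enum_val : 'I_#|T| -> T)) /=; last first.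
  by apply: onW_bij; exact: enum_val_bij.
apply: eq_bigr => i _; rewrite !mxE mul1r inE adj_sym.
by case: (G _ _).
Qed.

(** The all-ones vector is mapped to the vector of degrees. *)
Lemma sum_sqr_degree_le_rho (T : finType) (G : sgraph T) : (0 < #|T|)%N ->
  0 <= rho R G /\
  (\sum_x degree G x ^ 2)%N%:R <= rho R G ^+ 2 * #|T|%:R.
Proof.
move=> T_gt0.
have [m mE] : exists m, #|T| = m.+1 by exists #|T|.-1; rewrite prednK.
have Asym : (adjmx R G)^T = adjmx R G.
  by apply/matrixP => i j; rewrite !mxE adj_sym.
have Age0 i j : 0 <= adjmx R G i j by rewrite mxE ler0n.
have [r r_max [r_ge0 r_bound]] : exists2 r, largest_eigenvalue (adjmx R G) r &
    0 <= r /\ forall x : 'rV[R]_#|T|,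
      (x *m adjmx R G *m (adjmx R G *m x^T)) 0 0 <= r ^+ 2 * (x *m x^T) 0 0.
  move: (adjmx R G) Asym Age0; rewrite mE => A; exact: nonneg_symmetric_spectral_radius.
have -> : rho R G = r.
  rewrite /rho; apply: xget_unique => // s [s_eig s_max].
  by apply/eqP; rewrite eq_le r_max.2 // s_max // r_max.1.
split=> //; pose one : 'rV[R]_#|T| := const_mx 1.
have := r_bound one.
have -> : adjmx R G *m one^T = (one *m adjmx R G)^T by rewrite trmx_mul Asym.
have -> : (one *m one^T) 0 0 = (#|T|)%:R.
  rewrite mxE (eq_bigr (fun=> 1)) ?sumr_const ?card_ord //.
  by move=> i _; rewrite !mxE mul1r.
rewrite mxE; congr (_ <= _); rewrite natr_sum.
rewrite [in RHS](reindex (enum_val : 'I_#|T| -> T)) /=; last first.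
  by apply: onW_bij; exact: enum_val_bij.
apply: eq_bigr => i _; rewrite natrX -adjmx_row_sum expr2.
by congr (_ * _); rewrite mxE.
Qed.

End SymmetricSpectrum.

(** * From the spectral bound to the theorem *)

Lemma codegree_sum_le_fbound (R : realType) (n k t D S : nat) (r : R) :
  1 <= t -> 2 <= k -> (7 * k - 2) * t + 4 <= n ->
  (n + (k - 2) * t) * D <= 2 * S ->
  (0 <= r)%R -> (S%:R <= r ^+ 2 * n%:R)%R -> (r <= Num.sqrt (fbound R n k t))%R ->
  D + (k - 1) ^ 2 * t ^ 2 + 5 * k * t + 10
    <= 2 * (n - 1 - t) * ((k - 1) * t + 1) + 2 * n + 3 * t.
Proof.
move=> t1 k2 nlarge DS r0 Sr rf.
have [c kE] : exists c, k = c + 2 by exists (k - 2); rewrite subnK.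
subst k; have e1 : (7 * (c + 2) - 2) * t = 7 * (c * t) + 12 * t.
  by rewrite (_ : 7 * (c + 2) - 2 = 7 * c + 12) ?mulnDl ?mulnA //; lia.
have e2 : c + 2 - 1 = c + 1 by lia.
rewrite e1 in nlarge; rewrite addnK in DS; rewrite e2.
have [m nE] : exists m, n = m + t + 1 by exists (n - t - 1); lia.
subst n; have -> : m + t + 1 - 1 - t = m by lia.
rewrite /fbound in rf; set g := (_ - 5)%R in rf.
rewrite -(ler_nat R).
have gE : (2 * g = (2 * m * ((c + 1) * t + 1) + 2 * (m + t + 1) + 3 * t)%:R -
    ((c + 1) ^ 2 * t ^ 2 + 5 * (c + 2) * t + 10)%:R)%R.
  by rewrite /g !(natrD, natrM, natrX); field.
(* Needed to square the bound on [r], since [Num.sqrt] is 0 on negative numbers. *)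
have g0 : (0 <= g)%R.
  suff : (0 <= 2 * g)%R by rewrite pmulr_rge0 // ltr0n.
  rewrite gE subr_ge0 ler_nat.
  rewrite -expnMn -mulnA !(mulnDl c) mul1n.
  by move: (c * t) nlarge => a nlarge; nia.
have n0 : (0 < (m + t + 1)%:R :> R)%R by rewrite ltr0n addn1.
have a0 : (0 <= (c * t)%:R :> R)%R by [].
(* The identity $nf=(n+a)g$, by which $(n+a)D\le 2S\le 2nf$ becomes $D\le 2g$. *)
have fn : ((1 + ((c + 2)%:R - 2) * t%:R / (m + t + 1)%:R) * g * (m + t + 1)%:R =
    (m + t + 1 + c * t)%:R * g)%R.
  rewrite [in RHS](natrD _ (m + t + 1)) natrM (natrD _ c 2) addrK.
  by rewrite mulrAC mulrDl mul1r divfK // gt_eqF.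
set f := ((1 + _) * g)%R in rf fn.
have f0 : (0 <= f)%R.
  by rewrite -(pmulr_lge0 _ n0) fn mulr_ge0.
have rf2 : (r ^+ 2 <= f)%R by rewrite -(sqr_sqrtr f0) lerXn2r ?nnegrE ?sqrtr_ge0.
have DSR : ((m + t + 1 + c * t)%:R * D%:R <= 2 * S%:R :> R)%R.
  by rewrite -!natrM ler_nat.
have Sg : (S%:R <= (m + t + 1 + c * t)%:R * g)%R.
  by rewrite -fn; apply: le_trans Sr _; rewrite ler_pM2r.
have : (D%:R <= 2 * g)%R.
  have na0 : (0 < (m + t + 1 + c * t)%:R :> R)%R by rewrite natrD ltr_wpDr.
  rewrite -(ler_pM2l na0).
  by apply: le_trans DSR _; rewrite mulrCA ler_pM2l // ltr0n.
by rewrite gE lerBrDr -natrD !addnA.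
Qed.

Theorem theorem3p8 (R : realType) (t k n : nat)
  (ht : 1 <= t) (hk : 2 <= k) (hn : (7 * k - 2) * t + 4 <= n)
  (T : finType) (G : sgraph T) (hT : #|T| = n) (hG : t_connected t G)
  (hrho : (rho R (compl G) <= Num.sqrt (fbound R n k t))%R) :
  spanning_ktree k G \/ giso (gclosure (n - (k - 2) * t - 1) G) (Hstar n k t).
Proof.
set H := gclosure _ G.
have Hclosed : degree_closed (n - (k - 2) * t - 1) H := @gclosure_closed _ _ G.
have GH : subrel G H := @gclosure_sub _ _ G.
have [Hcompl|Hnc] := pselect (forall x y, x != y -> H x y).
  left; apply: bounded_spanning_ktree; apply: (bounded_spanning_gclosure hk hG).
  by rewrite hT; exact: bounded_spanning_complete.
right; apply: (closed_extremal ht hk hn hT (t_connected_sub GH hG) Hclosed).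
  have T0 : 0 < #|T| by have [tT _] := hG; apply: leq_ltn_trans tT.
  have [rho0 rho_ge] := sum_sqr_degree_le_rho R (compl G) T0.
  rewrite hT in rho_ge.
  apply: (codegree_sum_le_fbound ht hk hn _ rho0 rho_ge hrho).
  rewrite -hT in Hclosed.
  have H_codegree x y : compl H x y -> #|T| + (k - 2) * t <=
      degree (compl H) x + degree (compl H) y by exact: codegree_sum.
  (* The complement of [H] lies in that of [G], so its degrees are no larger. *)
  rewrite -{1}hT; apply: leq_trans (sum_degree_sqr_ge H_codegree) _.
  rewrite leq_mul2l /=; apply: leq_sum => x _; rewrite leq_sqr degree_sub //.
  by move=> a b /andP[ab nab]; rewrite /= /compl_rel ab; apply: contra nab => /GH.
apply: contrapT => Hc; apply: Hnc => x y xy; apply: contraT => nxy.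
by case: Hc; exists x, y; rewrite /= /compl_rel xy.
Qed.
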